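(* For every integer $k\ge 2$, the generating function $F_{12\text{-}3\text{-}\cdots\text{-}k}(x,y)$ is given by the continued fraction $$F_{12\text{-}3\text{-}\cdots\text{-}k}(x,y)=\cfrac{1}{1-x+xy^{d_1}-\cfrac{xy^{d_1}}{1-x+xy^{d_2}-\cfrac{xy^{d_2}}{1-x+xy^{d_3}-\cfrac{xy^{d_3}}{\cdots}}}},$$ where $d_i=\binom{i-1}{k-2}$ for $i\ge 1$, and $\binom ab$ is taken to be $0$ whenever $a<b$ or $b<0$.
   Context: Generalized patterns: a generalized pattern is a permutation $\tau=\tau_1\cdots\tau_k$ of $\{1,\dots,k\}$ written with dashes between some of its adjacent letters. An occurrence of $\tau$ in a permutation $\pi=\pi_1\cdots\pi_n\in S_n$ is a choice of positions $i_1<\dots<i_k$ such that $(\pi_{i_1},\dots,\pi_{i_k})$ is order-isomorphic to $(\tau_1,\dots,\tau_k)$ and $i_{j+1}=i_j+1$ whenever there is no dash between $\tau_j$ and $\tau_{j+1}$. The pattern $12\text{-}3\text{-}\cdots\text{-}k$ thus requires only the first two letters to be adjacent in $\pi$ (for $k=2$ it is $12$). A permutation is $1\text{-}3\text{-}2$-avoiding if it has no occurrence of the (fully dashed, i.e. classical) pattern $1\text{-}3\text{-}2$. For a generalized pattern $\tau$, $f_{\tau;r}(n)$ is the number of $1\text{-}3\text{-}2$-avoiding permutations in $S_n$ containing exactly $r$ occurrences of $\tau$ (with $S_0$ consisting of the empty permutation), and $F_\tau(x,y)=\sum_{n,r\ge 0} f_{\tau;r}(n)x^ny^r$, viewed as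 a formal power series in $x$ with coefficients in $\mathbb Z[y]$. The infinite continued fraction is a formal power series in $x$: writing $A_i=1-x+xy^{d_i}-xy^{d_i}/A_{i+1}$, it is the $x$-adic limit as $m\to\infty$ of the finite fractions $1/A_1$ obtained by setting $A_m=1$. *)

(* Defs.v *)
From HB Require Import structures.
From mathcomp Require Import all_boot all_order all_algebra all_fingroup.
From mathcomp Require Import boolp.

Set Implicit Arguments.
Unset Strict Implicit.
Unset Printing Implicit Defensive.

Import GRing.Theory.
Local Open Scope ring_scope.

(* Formal power series over R in one indeterminate, given by their
   coefficient sequence. *)
Record fps (R : Type) := Fps { coefs : nat -> R }.

Lemma fps_ext (R : Type) (s t : fps R) : coefs s =1 coefs t -> s = t.
Proof. by case: s t => [s] [t] /= /funext->. Qed.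

HB.instance Definition _ (R : Type) := gen_eqMixin (fps R).
HB.instance Definition _ (R : Type) := gen_choiceMixin (fps R).

Section FpsZmodule.
Variable R : zmodType.
Implicit Types s t : fps R.

Definition fps_zero : fps R := Fps (fun=> 0).
Definition fps_opp s := Fps (fun n => - coefs s n).
Definition fps_add s t := Fps (fun n => coefs s n + coefs t n).

Fact fps_addA : associative fps_add.
Proof. by move=> s t u; apply: fps_ext => n /=; rewrite addrA. Qed.
Fact fps_addC : commutative fps_add.
Proof. by move=> s t; apply: fps_ext => n /=; rewrite addrC. Qed.
Fact fps_add0 : left_id fps_zero fps_add.
Proof. by move=> s; apply: fps_ext => n /=; rewrite add0r. Qed.
Fact fps_addN : left_inverse fps_zero fps_opp fps_add.
Proof. by move=> s; apply: fps_ext => n /=; rewrite addNr. Qed.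

HB.instance Definition _ :=
  GRing.isZmodule.Build (fps R) fps_addA fps_addC fps_add0 fps_addN.

Lemma coefs0 n : coefs (0 : fps R) n = 0. Proof. by []. Qed.
Lemma coefsD s t n : coefs (s + t) n = coefs s n + coefs t n.
Proof. by []. Qed.
Lemma coefsN s n : coefs (- s) n = - coefs s n. Proof. by []. Qed.
Lemma coefsB s t n : coefs (s - t) n = coefs s n - coefs t n.
Proof. by []. Qed.
Lemma coefs_sum (I : Type) (r : seq I) (P : pred I) (F : I -> fps R) n :
  coefs (\sum_(i <- r | P i) F i) n = \sum_(i <- r | P i) coefs (F i) n.
Proof. exact: (big_morph (fun s => coefs s n) (fun s t => erefl) erefl). Qed.

End FpsZmodule.

Section FpsRing.
Variable R : comNzRingType.
Implicit Types s t u : fps R.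

Definition fpsC (c : R) : fps R := Fps (fun n => if n == 0%N then c else 0).

Definition fpsX : fps R := Fps (fun n => (n == 1%N)%:R).

Definition fps_mul s t : fps R :=
  Fps (fun n => \sum_(i < n.+1) coefs s i * coefs t (n - i)%N).

Let trunc n s : {poly R} := \poly_(i < n.+1) coefs s i.

Let coef_truncM n s t m : (m <= n)%N ->
  (trunc n s * trunc n t)`_m = coefs (fps_mul s t) m.
Proof.
move=> le_mn; rewrite coefM /=; apply: eq_bigr => i _.
have le_in : (i <= n)%N by rewrite (leq_trans _ le_mn) // -ltnS.
have le_sn : (m - i <= n)%N by rewrite (leq_trans _ le_mn) // leq_subr.
by rewrite !coef_poly !ltnS le_in le_sn.
Qed.

Fact fps_mulA : associative fps_mul.
Proof.
move=> s t u; apply: fps_ext => n.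
have E p q m : (m <= n)%N -> coefs (fps_mul p q) m = (trunc n p * trunc n q)`_m.
  by move=> lemn; rewrite coef_truncM.
have T p q m : (m <= n)%N ->
    (trunc n (fps_mul p q))`_m = (trunc n p * trunc n q)`_m.
  by move=> lemn; rewrite coef_poly ltnS lemn E.
rewrite !E // coefM [RHS]coefM.
under eq_bigr => i _ do rewrite T ?leq_subr //.
under [RHS]eq_bigr => i _ do rewrite (T _ _ _ (leq_ord i)).
by rewrite -!coefM mulrA.
Qed.

Fact fps_mulC : commutative fps_mul.
Proof.
by move=> s t; apply: fps_ext => n; rewrite -!(@coef_truncM n) // mulrC.
Qed.

Fact fps_mul1 : left_id (fpsC 1) fps_mul.
Proof.
move=> s; apply: fps_ext => n /=.
rewrite big_ord_recl /= mul1r subn0 big1 ?addr0 // => i _.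
by rewrite /= mul0r.
Qed.

Fact fps_mulDl : left_distributive fps_mul +%R.
Proof.
move=> s t u; apply: fps_ext => n; rewrite coefsD -big_split /=.
by apply: eq_bigr => i _; rewrite mulrDl.
Qed.

Fact fps_one_neq0 : fpsC 1 != 0.
Proof.
by apply/eqP => /(congr1 (fun s => coefs s 0)) /eqP; rewrite /= oner_eq0.
Qed.

HB.instance Definition _ := GRing.Zmodule_isComNzRing.Build (fps R)
  fps_mulA fps_mulC fps_mul1 fps_mulDl fps_one_neq0.

Lemma coefs1 n : coefs (1 : fps R) n = (n == 0%N)%:R.
Proof. by case: n. Qed.
Lemma coefsM s t n :
  coefs (s * t) n = \sum_(i < n.+1) coefs s i * coefs t (n - i)%N.
Proof. by []. Qed.
Lemma coefs0M s t : coefs (s * t) 0 = coefs s 0 * coefs t 0.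
Proof. by rewrite coefsM big_ord1. Qed.
Lemma coefsCM c s n : coefs (fpsC c * s) n = c * coefs s n.
Proof.
rewrite coefsM big_ord_recl /= subn0 big1 ?addr0 // => i _.
by rewrite /= mul0r.
Qed.
Lemma coefsXM s n :
  coefs (fpsX * s) n = if n is m.+1 then coefs s m else 0.
Proof.
rewrite coefsM big_ord_recl /= mul0r add0r.
case: n => [|n]; first by rewrite big_ord0.
rewrite big_ord_recl /= mul1r subSS subn0 big1 ?addr0 // => i _.
by rewrite /= mul0r.
Qed.

Lemma coefs_exp_small s n m : coefs s 0 = 0 -> (n < m)%N ->
  coefs (s ^+ m) n = 0.
Proof.
move=> s0; elim: m n => // m IHm n; rewrite ltnS => le_nm.
rewrite exprS coefsM big_ord_recl s0 mul0r add0r big1 // => i _.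
rewrite [X in _ * X]IHm ?mulr0 //= /bump leq0n add1n.
by case: n i le_nm => [[]//|n] i le_nm; rewrite subSS (leq_ltn_trans (leq_subr _ _)).
Qed.

End FpsRing.

Arguments fpsX {R}.

Section FpsUnit.
Variable R : comUnitRingType.
Implicit Types s t : fps R.

Definition fps_unit : {pred fps R} := fun s => coefs s 0 \is a GRing.unit.

(* With c the inverse of the constant term of s, the inverse of s is
   c * (1 + e + e^2 + ...), where e = 1 - c s has zero constant term. *)
Definition fps_inv s : fps R :=
  if fps_unit s then
    let c := fpsC (coefs s 0)^-1 in
    c * Fps (fun n => \sum_(j < n.+1) coefs ((1 - c * s) ^+ j) n)
  else s.

Fact fps_mulVr : {in fps_unit, left_inverse 1 fps_inv *%R}.
Proof.
move=> s s_unit; rewrite /fps_inv; have -> : fps_unit s by [].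
set c := fpsC _; set e := 1 - c * s; set G := Fps _ => /=.
have e0 : coefs e 0 = 0.
  by rewrite coefsB coefs1 coefs0M /= mulVr ?subrr.
suff: G * (1 - e) = 1 by rewrite subKr mulrCA mulrA.
apply: fps_ext => n; pose P := \sum_(j < n.+1) e ^+ j.
have GP m : (m <= n)%N -> coefs G m = coefs P m.
  move=> le_mn; rewrite /P coefs_sum /=.
  rewrite -(big_mkord xpredT (fun j => coefs (e ^+ j) m)).
  rewrite -[RHS](big_mkord xpredT (fun j => coefs (e ^+ j) m)).
  rewrite [RHS](@big_cat_nat _ _ _ m.+1) //= [X in _ + X]big1_seq ?addr0 //.
  move=> j /andP[_]; rewrite mem_index_iota => /andP[lt_mj _].
  exact: coefs_exp_small.
have -> : coefs (G * (1 - e)) n = coefs (P * (1 - e)) n.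
  by rewrite !coefsM; apply: eq_bigr => i _; rewrite GP // -ltnS.
have -> : P * (1 - e) = 1 - e ^+ n.+1.
  by rewrite mulrC -[in RHS](expr1n _ n.+1) subrXX; congr (_ * _);
     apply: eq_bigr => i _; rewrite expr1n mul1r.
by rewrite coefsB coefs_exp_small // subr0.
Qed.

Fact fps_unitPl s t : t * s = 1 -> fps_unit s.
Proof.
move=> /(congr1 (fun s => coefs s 0)); rewrite coefs0M coefs1 mulrC => ts1.
by apply/unitrPr; exists (coefs t 0).
Qed.

Fact fps_inv_out : {in [predC fps_unit], fps_inv =1 id}.
Proof. by move=> s /negbTE us; rewrite /fps_inv; have -> : fps_unit s = false. Qed.

HB.instance Definition _ := GRing.ComNzRing_hasMulInverse.Build (fps R)
  fps_mulVr fps_unitPl fps_inv_out.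

Lemma fps_unitE s : (s \is a GRing.unit) = (coefs s 0 \is a GRing.unit).
Proof. by []. Qed.

End FpsUnit.

(* s is the limit of the sequence u: for every N, u m = s modulo x^N for m
   large enough. *)
Definition xadic_lim (R : Type) (u : nat -> fps R) (s : fps R) : Prop :=
  forall N : nat, exists M : nat, forall m : nat, (M <= m)%N ->
    forall n : nat, (n < N)%N -> coefs (u m) n = coefs s n.

Lemma xadic_lim_unique (R : Type) (u : nat -> fps R) (s t : fps R) :
  xadic_lim u s -> xadic_lim u t -> s = t.
Proof.
move=> us ut; apply: fps_ext => n; have [M HM] := us n.+1; have [M' HM'] := ut n.+1.
by rewrite -(HM (maxn M M')) ?leq_maxl // -(HM' (maxn M M')) ?leq_maxr.
Qed.

(* A generalized pattern with k letters. Letters are numbered from 0, take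
   their values in {0, ..., k-1}, and [dash j] says that there is a dash
   between letters j and j+1; only the values of [dash] at j < k-1 matter. *)
Record gpattern (k : nat) := GPattern { letters : 'S_k; dash : nat -> bool }.

Definition is_occurrence (k n : nat) (tau : gpattern k) (pi : 'S_n)
    (i : {ffun 'I_k -> 'I_n}) : bool :=
  [&& [forall a : 'I_k, forall b : 'I_k, (a < b)%N ==> (i a < i b)%N],
      [forall a : 'I_k, forall b : 'I_k,
         (pi (i a) < pi (i b))%N == (letters tau a < letters tau b)%N]
    & [forall a : 'I_k, forall b : 'I_k,
         (b == a.+1 :> nat) && ~~ dash tau a ==> (i b == (i a).+1 :> nat)]].

Definition occurrences (k n : nat) (tau : gpattern k) (pi : 'S_n) : nat :=
  #|[set i : {ffun 'I_k -> 'I_n} | is_occurrence tau pi i]|.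

Definition avoids (k n : nat) (tau : gpattern k) (pi : 'S_n) : bool :=
  [forall i : {ffun 'I_k -> 'I_n}, ~~ is_occurrence tau pi i].

(* 1-3-2: exchanges the last two letters of 123. *)
Definition pat132 : gpattern 3 := GPattern (tperm (inord 1) (inord 2)) xpredT.

(* 12-3-...-k *)
Definition pat12 (k : nat) : gpattern k :=
  GPattern (1%g : 'S_k) (fun j => (0 < j)%N).

Definition f_count (k : nat) (tau : gpattern k) (r n : nat) : nat :=
  #|[set pi : 'S_n | avoids pat132 pi && (occurrences tau pi == r)]|.

(* The coefficient of x^n is the polynomial \sum_r f_count tau r n * y^r; the
   sum can be cut at r = n ^ k, see coefs_gen_fun. *)
Definition gen_fun (k : nat) (tau : gpattern k) : fps {poly int} :=
  Fps (fun n => \poly_(r < (n ^ k).+1) (f_count tau r n)%:R).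

Lemma coefs_gen_fun (k : nat) (tau : gpattern k) (n r : nat) :
  (coefs (gen_fun tau) n)`_r = (f_count tau r n)%:R.
Proof.
rewrite coef_poly ltnS; case: leqP => // lt_r.
rewrite /f_count (_ : [set pi | _] = set0) ?cards0 //.
apply/setP => pi; rewrite !inE; apply/negbTE; rewrite negb_and; apply/orP; right.
apply: contraTneq lt_r => <-; rewrite -leqNgt.
by rewrite (leq_trans (max_card _)) // card_ffun !card_ord.
Qed.

Section ContinuedFraction.
Variable d : nat -> nat.

(* x * y ^ e, as a power series in x *)
Definition xy (e : nat) : fps {poly int} := fpsX * fpsC ('X ^+ e).

(* A_i = 1 - x + x y^(d i) - x y^(d i) / A_(i+1), where A_(i+j) = 1. *)
Fixpoint cf_den (j i : nat) : fps {poly int} :=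
  if j is j'.+1 then 1 - fpsX + xy (d i) - xy (d i) / cf_den j' i.+1 else 1.

(* 1 / A_1, where A_m = 1; meant for m >= 1. *)
Definition cf_conv (m : nat) : fps {poly int} := (cf_den m.-1 1)^-1.

Lemma cf_den_unit (j i : nat) : cf_den j i \is a GRing.unit.
Proof.
case: j => [|j]; first exact: unitr1.
rewrite fps_unitE [cf_den _ _]/(1 - _ + _ - _) !(coefsB, coefsD) coefs1.
by rewrite /xy -mulrA !coefsXM !subr0 addr0 unitr1.
Qed.

End ContinuedFraction.

(* Main.v *)
(* Cut a nonempty 1-3-2-avoiding permutation at its maximum: pi = L n R, with
   L and R avoiding and every letter of L above every letter of R. Let occ_i
   count the occurrences of 12-3-...-k in pi followed by i larger increasing
   letters that may only play the roles 3, ..., k. An occurrence starts in R, or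
   in L with n acting as one more appended letter, or with 12 being the last
   letter of L and n, so that
     occ_i(L n R) = occ_(i+1)(L) + [L nonempty] * C(i, k-2) + occ_i(R).
   Hence the generating functions F_i of y^occ_i satisfy
     F_i * (1 - x + x y^C(i,k-2) - x y^C(i,k-2) F_(i+1)) = 1,
   and the tail of the continued fraction cut after j levels agrees with F_i up
   to x^j, since each level gains one power of x. *)

Require Import Defs.
From mathcomp Require Import all_boot all_algebra all_fingroup.
From mathcomp Require Import zify ring.

Set Implicit Arguments.
Unset Strict Implicit.
Unset Printing Implicit Defensive.

(** * Words cut at their maximum: chains and 132-avoidance *)

Fixpoint av132 (s : seq nat) : bool :=
  if s is a :: t then pairwise (fun b c => ~~ (a < c < b)) t && av132 t
  else true.

(* The number of increasing m-letter subsequences, with all letters above a,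
   of s followed by i further increasing letters larger than all those of s. *)
Fixpoint chains (i m a : nat) (s : seq nat) : nat :=
  if s is b :: t then
    chains i m a t + (if m is m'.+1 then (a < b) * chains i m' b t else 0)
  else 'C(i, m).

(* For i = 0, the number of occurrences of 12-3-...-(m+2) in s; in general the
   letters 3, ..., m+2 may also be taken from i larger letters appended to s. *)
Fixpoint asc_chains (i m : nat) (s : seq nat) : nat :=
  if s is a :: t then
    asc_chains i m t + (if t is b :: u then (a < b) * chains i m b u else 0)
  else 0.

Lemma chains0 i a s : chains i 0 a s = 1.
Proof. by elim: s => [|b s IHs] /=; rewrite ?bin0 // IHs. Qed.

Lemma chains_small i m a s :
  {in s, forall c, c <= a} -> chains i m a s = 'C(i, m).
Proof.
elim: s => //= b s IHs le_sa; rewrite IHs; last first.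
  by move=> c cs; rewrite le_sa // inE cs orbT.
by case: m {IHs} => [|m]; rewrite ?addn0 // ltnNge le_sa ?mem_head // addn0.
Qed.

(** Letters of [R] are too low to continue a chain above [a] or above a letter of [L], so only [n]
    remains usable after [L], and it acts as one more appended letter. *)
Lemma chains_cat_max i m a n L R :
    a < n -> {in R, forall c, c <= a} -> {in L, forall b, b < n} ->
    {in L & R, forall b c, c <= b} ->
  chains i m a (L ++ n :: R) = chains i.+1 m a L.
Proof.
elim: L m a => [|b L IHL] m a lt_an le_Ra lt_Ln le_RL /=.
  rewrite chains_small //; case: m => [|m]; first by rewrite !bin0.
  (* Pascal's rule, according to whether [n] is chosen. *)
  rewrite lt_an mul1n chains_small ?binS // => c /le_Ra le_ca.
  by rewrite (leq_trans le_ca) // ltnW.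
have lt_Ln' : {in L, forall b, b < n}.
  by move=> c cL; rewrite lt_Ln // inE cL orbT.
have le_RL' : {in L & R, forall b c, c <= b}.
  by move=> c e cL eR; apply: le_RL; rewrite // inE cL orbT.
rewrite IHL //; case: m => // m; rewrite IHL ?lt_Ln ?mem_head // => c cR.
by rewrite le_RL // mem_head.
Qed.

Lemma asc_chains_cons2 i m a b u :
  asc_chains i m (a :: b :: u) =
    asc_chains i m (b :: u) + (a < b) * chains i m b u.
Proof. by []. Qed.

Lemma asc_chains_cat_max i m n L R :
    {in L, forall b, b < n} -> {in R, forall c, c < n} ->
    {in L & R, forall b c, c <= b} ->
  asc_chains i m (L ++ n :: R) =
    asc_chains i.+1 m L + (L != [::]) * 'C(i, m) + asc_chains i m R.
Proof.
move=> lt_Ln lt_Rn; elim: L lt_Ln => [|a L IHL] lt_Ln le_RL.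
  rewrite mul0n !add0n /=; case: R lt_Rn le_RL {lt_Ln} => //= b R lt_Rn _.
  by rewrite [n < b]ltnNge ltnW ?lt_Rn ?mem_head // addn0.
have lt_Ln' : {in L, forall b, b < n}.
  by move=> c cL; rewrite lt_Ln // inE cL orbT.
have le_RL' : {in L & R, forall b c, c <= b}.
  by move=> c e cL eR; apply: le_RL; rewrite // inE cL orbT.
have {}IHL := IHL lt_Ln' le_RL'.
rewrite cat_cons; case: L => [|b L] in IHL lt_Ln le_RL lt_Ln' le_RL' *.
  (* The ascent from [a] to [n] plays 12; since [R] lies below [n], the other [m] letters come from
     the [i] appended ones. *)
  rewrite cat0s asc_chains_cons2 IHL lt_Ln ?mem_head // chains_small /=.
    lia.
  by move=> c /lt_Rn/ltnW.
rewrite cat_cons !asc_chains_cons2 IHL chains_cat_max; first by move=> /=; lia.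
- by rewrite lt_Ln' ?mem_head.
- by move=> c cR; rewrite le_RL' ?mem_head.
- by move=> c cL; rewrite lt_Ln' // inE cL orbT.
by move=> c e cL eR; rewrite le_RL' // inE cL orbT.
Qed.

Lemma chains_shift i m a r s :
  chains i m (r + a) [seq r + x | x <- s] = chains i m a s.
Proof.
elim: s m a => //= b s IHs [|m] a; rewrite !IHs //.
by rewrite ltn_add2l.
Qed.

Lemma asc_chains_shift i m r s :
  asc_chains i m [seq r + x | x <- s] = asc_chains i m s.
Proof.
elim: s => //= a [|b s] //= ->.
by rewrite ltn_add2l chains_shift.
Qed.

Lemma av132_shift r s : av132 [seq r + x | x <- s] = av132 s.
Proof.
elim: s => //= a s ->; rewrite pairwise_map; congr (_ && _).
by apply: eq_pairwise => b c /=; rewrite !ltn_add2l.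
Qed.

(** With [n] as the letter 3, avoidance forces [R] below [L]. Conversely, if [R] lies below [L], an
    occurrence starting in [L] can end neither in [R] nor at [n], and none starts at [n]. *)
Lemma av132_cat_max n L R :
    {in L, forall b, b < n} -> {in R, forall c, c < n} ->
    {in L & R, forall b c, b != c} ->
  av132 (L ++ n :: R) =
    [&& av132 L, av132 R & allrel (fun b c => c < b) L R].
Proof.
move=> lt_Ln lt_Rn; elim: L lt_Ln => [|a L IHL] lt_Ln neqLR.
  rewrite /= andbT; apply: andb_idl => _.
  apply/(pairwiseP 0) => x y _ yR _.
  by move: (lt_Rn _ (mem_nth 0 yR)) => /=; lia.
rewrite /= IHL; first last.
- by move=> c e cL eR; apply: neqLR; rewrite // inE cL orbT.
- by move=> c cL; rewrite lt_Ln // inE cL orbT.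
set P := fun b c => ~~ (a < c < b).
(* The pairs formed by [n] and a letter of [R] give the bound by [a]; this bound makes all other new
   pairs harmless. *)
have -> : pairwise P (L ++ n :: R) = pairwise P L && all (fun c => c < a) R.
  rewrite pairwise_cat pairwise_cons.
  have -> : all (P n) R = all (fun c => c < a) R.
    apply: eq_in_all => c cR; rewrite /P lt_Rn // andbT -leqNgt leq_eqVlt.
    by rewrite eq_sym (negPf (neqLR _ _ _ _)) ?mem_head.
  case: allP => [lt_Ra|_]; last by rewrite !andbF.
  rewrite (_ : pairwise P R); last first.
    apply/(pairwiseP 0) => x y _ yR _; rewrite /P.
    by move: (lt_Ra _ (mem_nth 0 yR)) => /=; lia.
  rewrite (_ : allrel P L (n :: R)) ?andbT //.
  apply/allrelP => b c bL; rewrite inE /P => /predU1P[->|/lt_Ra]; last lia.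
  by have := lt_Ln b; rewrite inE bL orbT => /(_ isT); lia.
rewrite allrel_consl.
by case: (pairwise P L) (av132 L) (av132 R) (all _ R) (allrel _ L R)
  => [] [] [] [] [].
Qed.

(** * Bijective decomposition of avoiding words *)

Definition avs (n : nat) : seq (seq nat) :=
  [seq s <- permutations (iota 0 n) | av132 s].

Lemma mem_avs n s : (s \in avs n) = av132 s && perm_eq s (iota 0 n).
Proof. by rewrite mem_filter mem_permutations. Qed.

(** Sorting [R] and [L] separately and concatenating gives a sorted rearrangement of [iota 0 n],
    hence [iota 0 n] itself, which is then split by length. *)
Lemma perm_eq_iota_cat n L R :
    perm_eq (L ++ R) (iota 0 n) -> allrel (fun b c => c < b) L R ->
  perm_eq R (iota 0 (size R)) /\ perm_eq L (iota (size R) (size L)).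
Proof.
move=> LRn ltRL; set r := size R.
have nE : n = r + size L.
  by rewrite -(size_iota 0 n) -(perm_size LRn) size_cat addnC.
have: sort leq R ++ sort leq L = iota 0 n.
  apply: (sorted_eq leq_trans anti_leq); last first.
  - by rewrite perm_catC (perm_trans _ LRn) // perm_cat ?perm_sort.
  - exact: iota_sorted.
  rewrite (sorted_pairwise leq_trans) pairwise_cat.
  rewrite -!(sorted_pairwise leq_trans) !sort_sorted ?andbT;
    try exact: leq_total.
  apply/allrelP => c b; rewrite !mem_sort => cR bL.
  by apply: ltnW; apply: (allrelP ltRL).
rewrite nE iotaD add0n => /eqP; rewrite eqseq_cat ?size_sort ?size_iota //.
by case/andP=> /eqP <- /eqP <-; rewrite !(perm_sym _ (sort _ _)) !perm_sort.
Qed.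

(** Inverse of the cut: with [r] the length of [R], the shift lifts [L] above [R]. *)
Definition join_max (n r : nat) (L R : seq nat) : seq nat :=
  [seq r + x | x <- L] ++ n :: R.

(* In a 132-avoiding word each letter before the maximum exceeds each letter
   after it; for words on 0, ..., n this fixes the letters on either side. *)
Lemma avs_join n l : l <= n ->
  perm_eq [seq s <- avs n.+1 | index n s == l]
    [seq join_max n (n - l) L R | L <- avs l, R <- avs (n - l)].
Proof.
move=> le_ln; apply: uniq_perm.
- by rewrite !filter_uniq // permutations_uniq.
- apply: allpairs_uniq => [||[L R] [L' R']];
    try by rewrite filter_uniq ?permutations_uniq.
  case/allpairsP=> -[L1 R1] /= [L1l R1n [-> ->]].
  case/allpairsP=> -[L2 R2] /= [L2l R2n [-> ->]] {L R L' R'}.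
  (* Both left parts have length [l], so equal words have equal parts. *)
  rewrite /join_max => /eqP; rewrite eqseq_cat; last first.
    move: L1l L2l; rewrite !mem_avs !size_map.
    by case/andP=> _ /perm_size-> /andP[_ /perm_size->].
  case/andP=> /eqP/(inj_map (@addnI _))-> /eqP[->] //.
move=> s; apply/idP/idP.
  rewrite mem_filter mem_avs => /and3P[/eqP sl avs sn].
  have ns : n \in s by rewrite (perm_mem sn) mem_iota /= add0n.
  case/splitPr: ns => [L R] in sl avs sn *.
  have: uniq (L ++ n :: R) by rewrite (perm_uniq sn) iota_uniq.
  rewrite cat_uniq /= negb_or -!andbA => /and5P[_ nL LR _ _].
  have Ll : size L = l by rewrite -sl index_cat (negPf nL) /= eqxx addn0.
  have LRn : perm_eq (L ++ R) (iota 0 n).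
    move: sn; rewrite -[n.+1]addn1 iotaD /= add0n => sn.
    rewrite -(perm_cons n) (perm_trans _ (perm_trans sn _)) //.
      by rewrite -cat1s perm_catCA.
    by rewrite perm_catC.
  have lt_n : {in L ++ R, forall x, x < n}.
    by move=> x; rewrite (perm_mem LRn) mem_iota.
  move: avs; rewrite av132_cat_max; first last.
  - move=> b c bL cR; apply: contraNneq LR => bc; apply/hasP.
    by exists c; rewrite //= -bc.
  - by move=> c cR; rewrite lt_n // mem_cat cR orbT.
  - by move=> c cL; rewrite lt_n // mem_cat cL.
  case/and3P=> avL avR ltRL.
  have Rn : size R = n - l.
    by have := perm_size LRn; rewrite size_cat size_iota Ll; lia.
  have [Rr Lr] := perm_eq_iota_cat LRn ltRL.
  (* No truncation occurs: the letters of [L] are at least [n - l]. *)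
  have LE : L = [seq (n - l) + x | x <- [seq x - (n - l) | x <- L]].
    rewrite -map_comp map_id_in // => x; rewrite (perm_mem Lr) mem_iota Rn /=.
    by lia.
  apply/allpairsP; exists ([seq x - (n - l) | x <- L], R); split => /=.
  - rewrite mem_avs -(av132_shift (n - l)) -LE avL /=.
    apply: (perm_map_inj (@addnI (n - l))).
    rewrite -LE -iotaDl addn0 -{2}Ll -Rn.
    exact: Lr.
  - by rewrite mem_avs avR -Rn.
  by rewrite /join_max -LE.
case/allpairsP=> -[L R] /= [].
rewrite !mem_avs => /andP[avL Ll] /andP[avR Rn] ->.
have lt_Rn : {in R, forall c, c < n - l}.
  by move=> x; rewrite (perm_mem Rn) mem_iota.
have lt_Ln : {in [seq n - l + x | x <- L], forall c, n - l <= c < n}.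
  by move=> _ /mapP[x + ->]; rewrite (perm_mem Ll) mem_iota; lia.
have nL : n \notin [seq n - l + x | x <- L].
  by apply/negP => /lt_Ln; rewrite ltnn andbF.
rewrite mem_filter mem_avs /join_max index_cat (negPf nL).
rewrite [index _ (_ :: _)]/= eqxx addn0.
rewrite size_map (perm_size Ll) size_iota eqxx andTb; apply/andP; split.
  rewrite av132_cat_max ?av132_shift ?avL ?avR /=.
  - by apply/allrelP => b c /lt_Ln bL /lt_Rn cR; lia.
  - by move=> b /lt_Ln; lia.
  - by move=> c /lt_Rn; lia.
  by move=> b c /lt_Ln bL /lt_Rn cR; lia.
(* The [+ 0] lets [iotaDl] turn the middle block into a shift of [iota 0 l]. *)
have -> : iota 0 n.+1 = (iota 0 (n - l) ++ iota (n - l + 0) l) ++ [:: n].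
  by rewrite addn0 -(iotaD 0 (n - l)) subnK // -[n.+1]addn1 iotaD.
rewrite iotaDl -cat1s perm_catCA perm_catC perm_cat2r perm_catC.
by rewrite perm_cat ?perm_map.
Qed.

(** * Generating functions and the continued fraction *)

Section GeneratingFunctions.
Import GRing.Theory.
Local Open Scope ring_scope.

(** The coefficient of x^n in F_i, where m = k - 2 and ['X] stands for y. *)
Definition asc_poly (i m n : nat) : {poly int} :=
  \sum_(s <- avs n) 'X^(asc_chains i m s).

Lemma asc_poly0 i m : asc_poly i m 0 = 1.
Proof. by rewrite /asc_poly big_seq1. Qed.

(** Words are grouped by the index [l] of their maximum; the additive formula of
    [asc_chains_cat_max] becomes a product of powers of y. *)
Lemma asc_polyS i m n :
  asc_poly i m n.+1 =
    \sum_(l < n.+1) 'X^((l != 0 :> nat) * 'C(i, m)) *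
      asc_poly i.+1 m l * asc_poly i m (n - l).
Proof.
pose F s : {poly int} := 'X^(asc_chains i m s).
transitivity (\sum_(l < n.+1) \sum_(s <- avs n.+1 | index n s == l) F s).
  rewrite (exchange_big_dep xpredT) //=; rewrite /asc_poly !big_seq.
  apply: eq_bigr => s; rewrite mem_avs => /andP[_ sn].
  have lt_in : (index n s < n.+1)%N.
    rewrite -[X in (_ < X)%N](size_iota 0) -(perm_size sn) index_mem.
    by rewrite (perm_mem sn) mem_iota /=.
  by rewrite (big_pred1 (Ordinal lt_in)).
apply: eq_bigr => l _; have le_ln : (l <= n)%N by rewrite -ltnS.
rewrite -big_filter (perm_big _ (avs_join le_ln)) /= big_allpairs_dep /=.
rewrite -mulrA big_distrlr /= big_distrr /= !big_seq.
apply: eq_bigr => L; rewrite mem_avs => /andP[_ Ll].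
rewrite big_distrr /= !big_seq.
apply: eq_bigr => R; rewrite mem_avs => /andP[_ Rn].
rewrite /F -!exprD /join_max asc_chains_cat_max.
- rewrite asc_chains_shift -size_eq0 size_map (perm_size Ll) size_iota.
  by congr ('X^ _); lia.
- by move=> _ /mapP[x + ->]; rewrite (perm_mem Ll) mem_iota; lia.
- by move=> c; rewrite (perm_mem Rn) mem_iota; lia.
by move=> _ c /mapP[x _ ->]; rewrite (perm_mem Rn) mem_iota; lia.
Qed.

Definition asc_fps (i m : nat) : fps {poly int} := Fps (asc_poly i m).

Lemma asc_fps_eq i m :
  asc_fps i m *
    (1 - fpsX + xy 'C(i, m) - xy 'C(i, m) * asc_fps i.+1 m) = 1.
Proof.
set F := asc_fps i m; set G := asc_fps i.+1 m.
pose c : {poly int} := 'X^'C(i, m).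
(* The recurrence as series: an empty left part contributes x F, the nonempty ones x c (G - 1) F. *)
suff {2}-> : 1 = F - fpsX * (F + fpsC c * (G - 1) * F).
  by rewrite /xy -/c; ring.
apply: fps_ext => n; rewrite coefsB coefs1 coefsXM.
case: n => [|n]; first by rewrite subr0 /= asc_poly0.
have E : coefs (fpsC c * (G - 1) * F) n =
    \sum_(l < n) c * asc_poly i.+1 m l.+1 * asc_poly i m (n - l.+1).
  rewrite coefsM big_ord_recl coefsCM coefsB coefs1 [coefs G _]asc_poly0.
  rewrite subrr mulr0 mul0r add0r; apply: eq_bigr => l _.
  by rewrite coefsCM coefsB coefs1 subr0.
rewrite coefsD E [coefs F n.+1]asc_polyS big_ord_recl asc_poly0 !mul1r subn0.
under [X in _ + X - _]eq_bigr => l _ do rewrite mul1n.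
by rewrite subrr.
Qed.

Lemma coefsM_small (R : comNzRingType) (s t : fps R) N :
    (forall n, (n < N)%N -> coefs s n = 0) ->
  forall n, (n < N)%N -> coefs (s * t) n = 0.
Proof.
move=> s0 n lt_nN; rewrite coefsM big1 // => i _.
by rewrite s0 ?mul0r // (leq_ltn_trans _ lt_nN) // -ltnS.
Qed.

(** The error at one level is x times the error at the next level times a power series, so each
    level gains a degree. Levels are numbered from 1, hence [i.+1] against F_i. *)
Lemma cf_den_inv_coefs m j i n : (n <= j)%N ->
  coefs (cf_den (fun i => 'C(i.-1, m)) j i.+1)^-1 n = asc_poly i m n.
Proof.
elim: j i n => [|j IHj] i n le_nj.
  by move: le_nj; rewrite leqn0 => /eqP->; rewrite invr1 coefs1 asc_poly0.
set A := cf_den _ _ _; set F := asc_fps i m.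
set G := (cf_den (fun i => 'C(i.-1, m)) j i.+2)^-1.
have AE : A = 1 - fpsX + xy 'C(i, m) - xy 'C(i, m) * G by [].
have uA : A \is a GRing.unit by apply: cf_den_unit.
apply/eqP; rewrite -subr_eq0 -[asc_poly i m n]/(coefs F n) -coefsB; apply/eqP.
have -> : A^-1 - F =
    fpsX * (G - asc_fps i.+1 m) * (fpsC 'X^'C(i, m) * F * A^-1).
  apply: (mulIr uA); rewrite mulrBl mulVr // -(asc_fps_eq i m) -/F.
  by rewrite -!mulrA mulVr // AE /xy; ring.
(* The next error vanishes through degree [j], so x times it vanishes through degree [j.+1]. *)
apply: (@coefsM_small _ _ _ j.+2) => // -[|p] lt_pj; rewrite coefsXM //.
by rewrite coefsB IHj ?subrr.
Qed.

End GeneratingFunctions.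

(** * Permutations as words *)

Section Words.
Variable n : nat.
Implicit Type pi : 'S_n.

Definition word pi : seq nat := [seq val (pi i) | i <- enum 'I_n].

Lemma size_word pi : size (word pi) = n.
Proof. by rewrite size_map size_enum_ord. Qed.

Lemma nth_word pi (i : 'I_n) : nth 0 (word pi) i = pi i.
Proof. by rewrite (nth_map i) ?size_enum_ord // nth_ord_enum. Qed.

Lemma word_inj : injective word.
Proof.
move=> pi rho eq_w; apply/permP => i; apply: val_inj.
by rewrite /= -!nth_word eq_w.
Qed.

(** [word] is injective and both lists have n! elements, so inclusion suffices. *)
Lemma perm_words :
  perm_eq [seq word pi | pi <- enum 'S_n] (permutations (iota 0 n)).
Proof.
have Uw : uniq [seq word pi | pi <- enum 'S_n].
  by rewrite (map_inj_uniq word_inj) enum_uniq.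
apply: uniq_perm => //; first exact: permutations_uniq.
apply: (uniq_min_size Uw _ _).2; last first.
  rewrite size_permutations ?iota_uniq // size_iota size_map -cardE.
  by rewrite -(card_Sn n); apply: eq_leq; apply: eq_card => pi; rewrite inE.
move=> _ /mapP[pi _ ->]; rewrite mem_permutations; apply: uniq_perm.
- by rewrite map_inj_uniq ?enum_uniq // => i j /val_inj/perm_inj.
- exact: iota_uniq.
move=> x; rewrite mem_iota /= add0n; apply/mapP/idP => [[i _ ->]|lt_xn].
  exact: ltn_ord.
by exists (pi^-1 (Ordinal lt_xn))%g; rewrite ?mem_enum // permKV.
Qed.

End Words.

Lemma av132P (s : seq nat) :
  reflect (forall p q r, p < q -> q < r -> r < size s ->
             ~~ (nth 0 s p < nth 0 s r < nth 0 s q)) (av132 s).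
Proof.
elim: s => [|a s IHs] /=; first by constructor.
apply: (iffP andP) =>
  [[/(pairwiseP 0) Pa /IHs Ps] [|p] [|q] [|r] //= pq qr rs|Ps].
- by apply: Pa; rewrite ?inE /=; lia.
- exact: Ps.
split; last by apply/IHs => p q r pq qr rs; apply: (Ps p.+1 q.+1 r.+1).
by apply/(pairwiseP 0) => q r qs rs qr; apply: (Ps 0 q.+1 r.+1).
Qed.

Lemma letters_pat132 (a : 'I_3) :
  letters pat132 a = nth 0 [:: 0; 2; 1] a :> nat.
Proof.
have E j : j < 3 -> (inord j : 'I_3) = j :> nat by move=> ?; rewrite inordK.
rewrite /= permE /= -!val_eqE /= !E //.
by case: a => [[|[|[|]]] //= _]; rewrite !E.
Qed.

Lemma avoids_pat132 n (pi : 'S_n) : avoids pat132 pi = av132 (word pi).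
Proof.
apply/forallP/av132P => [av p q r pq qr|av f]; last first.
  apply/negP => /and3P[/forallP incf /forallP pif _].
  pose o (i : nat) (lt_i3 : i < 3) := Ordinal lt_i3.
  have lt01 := forallP (incf (@o 0 isT)) (@o 1 isT).
  have lt12 := forallP (incf (@o 1 isT)) (@o 2 isT).
  have lt02 := forallP (pif (@o 0 isT)) (@o 2 isT).
  have lt21 := forallP (pif (@o 2 isT)) (@o 1 isT).
  move: lt02 lt21; rewrite !letters_pat132 /= => /eqP lt02 /eqP lt21.
  have := av _ _ _ lt01 lt12; rewrite size_word !nth_word => /(_ (ltn_ord _)).
  by rewrite lt02 lt21.
rewrite size_word => rn; have qn := ltn_trans qr rn; have pn := ltn_trans pq qn.
(* The candidate occurrence sits at positions [p], [q], [r]; the default of [nth] is never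
   reached. *)
apply: contra (av [ffun a : 'I_3 =>
  nth (Ordinal pn) [:: Ordinal pn; Ordinal qn; Ordinal rn] a]).
rewrite (nth_word pi (Ordinal pn)) (nth_word pi (Ordinal qn)).
rewrite (nth_word pi (Ordinal rn)) => /andP[pr rq].
apply/and3P; split; apply/forallP => a; apply/forallP => b.
all: rewrite ?letters_pat132 !ffunE.
all: case: a b => [[|[|[|?]]] ?] [[|[|[|?]]] ?] //=.
all: by rewrite ?andbF //; lia.
Qed.

(** * Occurrences counted position by position *)

Lemma chains_drop m a s j :
  chains 0 m.+1 a (drop j s) =
    \sum_(j <= q < size s)
      (a < nth 0 s q) * chains 0 m (nth 0 s q) (drop q.+1 s).
Proof.
have [k] := ubnP (size s - j); elim: k => // k IHk in j *.
case: (leqP (size s) j) => [le_sj _|lt_js lt_k].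
  (* The empty word contributes ['C(0, m.+1)], which is 0. *)
  by rewrite drop_oversize // big_geq.
rewrite (drop_nth 0 lt_js) big_ltn // -IHk; last lia.
by rewrite addnC.
Qed.

Lemma asc_chains_drop m s j :
  asc_chains 0 m (drop j s) =
    \sum_(j <= p < size s)
      ((p.+1 < size s) && (nth 0 s p < nth 0 s p.+1)) *
      chains 0 m (nth 0 s p.+1) (drop p.+2 s).
Proof.
have [k] := ubnP (size s - j); elim: k => // k IHk in j *.
case: (leqP (size s) j) => [le_sj _|lt_js lt_k].
  by rewrite drop_oversize // big_geq.
rewrite (drop_nth 0 lt_js) big_ltn // -IHk; last lia.
case: (ltnP j.+1 (size s)) => [lt_j1s|le_sj1]; last by rewrite drop_oversize.
by rewrite (drop_nth 0 lt_j1s) addnC.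
Qed.

Lemma card_set_andb (T : finType) (b : bool) (P : pred T) :
  #|[set x | b && P x]| = b * #|[set x | P x]|.
Proof.
case: b; first by rewrite mul1n.
rewrite mul0n; apply/eqP; rewrite cards_eq0; apply/eqP/setP => x.
by rewrite !inE.
Qed.

Section ChainFunctions.
Variables (T : finType) (r : rel T).

Definition ffun_cons m (p : T) (g : {ffun 'I_m -> T}) : {ffun 'I_m.+1 -> T} :=
  [ffun a => oapp g p (unlift ord0 a)].

Lemma ffun_cons0 m p (g : {ffun 'I_m -> T}) : ffun_cons p g ord0 = p.
Proof. by rewrite ffunE unlift_none. Qed.

Lemma ffun_consS m p (g : {ffun 'I_m -> T}) a :
  ffun_cons p g (lift ord0 a) = g a.
Proof. by rewrite ffunE liftK. Qed.

Lemma card_ffun_cons m (P : pred {ffun 'I_m.+1 -> T}) :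
  #|[set f | P f]| = \sum_p #|[set g | P (ffun_cons p g)]|.
Proof.
pose h (u : T * {ffun 'I_m -> T}) := ffun_cons u.1 u.2.
have h_bij : bijective h.
  exists (fun f : {ffun 'I_m.+1 -> T} =>
            (f ord0, [ffun a : 'I_m => f (lift ord0 a)])) => [[p g]|f].
    rewrite /h /= ffun_cons0; congr (_, _).
    by apply/ffunP => a; rewrite ffunE ffun_consS.
  apply/ffunP => a; case: (unliftP ord0 a) => [b|] ->.
    by rewrite ffun_consS ffunE.
  by rewrite ffun_cons0.
rewrite -sum1_card (reindex h) /=; last exact: onW_bij.
under [RHS]eq_bigr do rewrite -sum1_card.
rewrite pair_big_dep /=; apply: eq_bigl => -[p g].
by rewrite !inE.
Qed.

Definition chain_ffun m (f : {ffun 'I_m -> T}) : bool :=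
  [forall a : 'I_m, forall b : 'I_m, (a < b) ==> r (f a) (f b)].

Lemma chain_ffunP m (f : {ffun 'I_m -> T}) :
  reflect (forall a b : 'I_m, a < b -> r (f a) (f b)) (chain_ffun f).
Proof.
apply: (iffP forallP) => Cf a.
  by move=> b; apply: implyP (forallP (Cf a) b).
by apply/forallP => b; apply/implyP/Cf.
Qed.

(** By transitivity, [p] needs comparing only with its successor [q]. *)
Lemma chain_ffun_cons2 m p q (g : {ffun 'I_m -> T}) :
    transitive r ->
  chain_ffun (ffun_cons p (ffun_cons q g)) =
    r p q && chain_ffun (ffun_cons q g).
Proof.
move=> r_trans; apply/chain_ffunP/andP => [Cf|[pq /chain_ffunP Cg] a b].
  split.
    by have := Cf ord0 (lift ord0 ord0); rewrite ffun_consS !ffun_cons0 => ->.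
  apply/chain_ffunP => a b ab; have := Cf (lift ord0 a) (lift ord0 b).
  by rewrite !ffun_consS => ->.
case: (unliftP ord0 b) => [b'|] -> //; rewrite ffun_consS.
case: (unliftP ord0 a) => [a'|] -> /=; first by rewrite ffun_consS => /Cg.
rewrite ffun_cons0 => _.
case: (unliftP ord0 b') => [c|] ->; last by rewrite ffun_cons0.
by apply: r_trans pq _; rewrite -[q in r q _](ffun_cons0 q g); apply: Cg.
Qed.

End ChainFunctions.

Section Occurrences.
Variables (n : nat) (pi : 'S_n).

(** Merges the conditions on positions and values, so that increasing occurrences become chains of a
    single transitive relation. *)
Definition ascent : rel 'I_n := fun p q => (p < q) && (pi p < pi q).

Lemma ascent_trans : transitive ascent.
Proof.
move=> q p s /andP[pq Ppq] /andP[qs Pqs].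
by apply/andP; split; [apply: ltn_trans qs | apply: ltn_trans Pqs].
Qed.

Lemma card_chain_ffun m (p : 'I_n) :
  #|[set g : {ffun 'I_m -> 'I_n} | chain_ffun ascent (ffun_cons p g)]| =
    chains 0 m (pi p) (drop p.+1 (word pi)).
Proof.
elim: m p => [|m IHm] p.
  rewrite chains0 (_ : [set g | _] = setT) ?cardsT ?card_ffun ?card_ord //.
  by apply/setP => g; rewrite !inE; apply/chain_ffunP => -[[|//] ?] [[|//] ?].
(* Both counts sum over the next position [q]; the sum from [p.+1] is widened to all positions,
   filtered by [p < q]. *)
rewrite card_ffun_cons chains_drop size_word (@big_nat_widenl _ _ _ p.+1 0) //.
rewrite big_mkord [RHS]big_mkcond; apply: eq_bigr => q _.
under eq_finset => g do rewrite (chain_ffun_cons2 _ _ _ ascent_trans).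
rewrite card_set_andb IHm /ascent /= nth_word.
by case: (p < q); rewrite ?mul0n.
Qed.

Lemma is_occurrence_pat12 m (f : {ffun 'I_m.+2 -> 'I_n}) :
  is_occurrence (pat12 m.+2) pi f =
    chain_ffun ascent f && (f (lift ord0 ord0) == (f ord0).+1 :> nat).
Proof.
apply/and3P/andP; last first.
  case=> /chain_ffunP Cf /eqP f01.
  have pif (a b : 'I_m.+2) : a < b -> pi (f a) < pi (f b) by move=> /Cf/andP[].
  split; apply/forallP => a; apply/forallP => b.
  - by apply/implyP => /Cf/andP[].
  (* The value condition is an equivalence; totality of the order on letters gives its converse
     half. *)
  - rewrite /= !perm1; case: (ltngtP a b) => [/pif -> //|/pif|/val_inj->].
      by move=> ba; rewrite ltnNge ltnW.
    by rewrite ltnn.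
  (* The only missing dash is the one after letter 0. *)
  apply/implyP => /andP[/eqP ba] /=; rewrite -eqn0Ngt => /eqP a0.
  have -> : a = ord0 by apply: val_inj.
  have -> : b = lift ord0 ord0 by apply: val_inj; rewrite /= ba a0.
  by rewrite f01.
case=> /forallP incf /forallP pif /forallP adj; split; last first.
  by apply: (implyP (forallP (adj ord0) _)).
apply/chain_ffunP => a b ab; apply/andP; split.
  exact: (implyP (forallP (incf a) b)).
by rewrite (eqP (forallP (pif a) b)) !perm1.
Qed.

(** Once the position [p] of the first letter is fixed, adjacency leaves only [p.+1] for the second,
    and [card_chain_ffun] counts the rest. *)
Lemma occurrences_pat12 m :
  occurrences (pat12 m.+2) pi = asc_chains 0 m (word pi).
Proof.
rewrite -[word pi]drop0 asc_chains_drop size_word big_mkord /occurrences.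
rewrite card_ffun_cons; apply: eq_bigr => p _; rewrite card_ffun_cons.
have E (q : 'I_n) :
    #|[set g : {ffun 'I_m -> 'I_n} |
        is_occurrence (pat12 m.+2) pi (ffun_cons p (ffun_cons q g))]| =
      ((q == p.+1 :> nat) && ascent p q) *
      chains 0 m (pi q) (drop q.+1 (word pi)).
  under eq_finset => g do
    rewrite is_occurrence_pat12 (chain_ffun_cons2 _ _ _ ascent_trans) ffun_consS
      !ffun_cons0 andbC andbA.
  by rewrite card_set_andb card_chain_ffun.
under eq_bigr => q _ do rewrite E.
case: (ltnP p.+1 n) => [lt_pn|le_np]; last first.
  rewrite big1 // => q _; case: eqP => // qp.
  by have := ltn_ord q; rewrite qp ltnNge le_np.
rewrite (bigD1 (Ordinal lt_pn)) //= big1 ?addn0 => [|q neq_q].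
  rewrite eqxx /ascent /= ltnSn (nth_word pi p).
  by rewrite (nth_word pi (Ordinal lt_pn)).
by rewrite (_ : (q == p.+1 :> nat) = false) //; apply: negbTE.
Qed.

End Occurrences.

(** * From the pattern's series to the limit *)

Section Main.
Import GRing.Theory.
Local Open Scope ring_scope.

Lemma coefs_gen_fun_pat12 m n :
  coefs (gen_fun (pat12 m.+2)) n = asc_poly 0 m n.
Proof.
rewrite /asc_poly big_filter -(perm_big _ (perm_words n)) big_map.
rewrite big_enum_cond /=.
(* At y^r, an avoiding permutation contributes 1 exactly when it has [r] occurrences. *)
apply/polyP => r; rewrite coefs_gen_fun coef_sum /f_count -sum1_card natr_sum.
rewrite big_mkcond [RHS]big_mkcond; apply: eq_bigr => pi _.
rewrite !inE avoids_pat132 occurrences_pat12 eq_sym.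
by case: (av132 _); rewrite //= coefXn; case: eqP.
Qed.

End Main.

Theorem theorem2p1 (k : nat) (hk : 2 <= k) :
  xadic_lim (cf_conv (fun i : nat => 'C(i.-1, k - 2))) (gen_fun (pat12 k)).
Proof.
(* The [j]-th convergent has [j.-1] levels, and [n < N <= j] gives [n <= j.-1]. *)
case: k hk => [|[|m]] // _ N; exists N => j le_Nj n lt_nN.
by rewrite !subSS subn0 coefs_gen_fun_pat12 /cf_conv cf_den_inv_coefs //; lia.
Qed.
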